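(* Let $(V,E)$ be a connected graph, let $\mathcal{M}^I\subseteq V$, $\mathcal{M}^P\subseteq V$, and let $\mathcal{M}^L=\emptyset$. Then the perfect protection problem is equivalent to the integer program (DOM) defined in the context: both have the same objective function, depending on $(x,z)$ only, and for binary vectors $x\in\{0,1\}^V$, $z\in\{0,1\}^V$ with $x_i=0$ for $i\notin\mathcal{M}^I$ and $z_k=0$ for $k\notin\mathcal{M}^P$, the pair $(x,z)$ satisfies the perfect protection constraint if and only if there exists $w$ such that $(x,z,w)$ is feasible for (DOM).
   Context: Graphs are finite and undirected; edges are unordered pairs of two nodes. Let $0$ be an additional node not in $V$. The sets $\mathcal{M}^I$, $\mathcal{M}^L\subseteq E$, $\mathcal{M}^P$ are respectively the buses with measured power injections, the lines with measured power flows, and the buses with a phasor measurement unit. Costs $c^I_i$ ($i\in\mathcal{M}^I$), $c^P_k$ ($k\in\mathcal{M}^P$) are given real numbers. Perfect protection problem (with $\mathcal{M}^L=\emptyset$, i.e. no line power flow measurements): over binary $x\in\{0,1\}^V$, $z\in\{0,1\}^V$ with $x_i=0$ for $i\notin\mathcal{M}^I$ and $z_k=0$ for $k\notin\mathcal{M}^P$, minimize $\sum_{i\in\mathcal{M}^I}c^I_ix_i+\sum_{k\in\mathcal{M}^P}c^P_kz_k$ subject to the perfect protection constraint: there exists $g:I(x)\to E$ with $i\in g(i)$ for all $i\in I(x)$ such that the graph $(V\cup\{0\},\,E_{P0}(z)\cup g(I(x)))$ is connected. Here $I(x)=\{i\in V\mid x_i=1\}$, $P(z)=\{i\in V\mid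 z_i=1\text{ or there is }k\in V\text{ with }z_k=1,\ \{i,k\}\in E\}$, $E_{P0}(z)=\{\{i,0\}\mid i\in P(z)\}$, and $g(I(x))=\{g(i)\mid i\in I(x)\}$. Integer program (DOM): over $x\in\{0,1\}^V$ with $x_i=0$ for $i\notin\mathcal{M}^I$, $z\in\{0,1\}^V$ with $z_k=0$ for $k\notin\mathcal{M}^P$, and $w_{ij}\in\{0,1\}$ for $i,j\in V$, minimize the same objective subject to: 1. $z_i+\sum_{k:\{i,k\}\in E}z_k+\sum_{j\in V}w_{ij}\ge1$ for all $i\in V$; 2. $\sum_{i\in V}w_{ij}\le x_j$ for all $j\in V$; 3. $w_{ij}=0$ for all $i\ne j$ with $\{i,j\}\notin E$; 4. $\sum_{k\in\mathcal{M}^P}z_k\ge1$.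
   Formalization: The one-node graph with both $\mathcal{M}^I$ and $\mathcal{M}^P$ nonempty is excluded, since there $x_v=z_v=1$, $w=0$ is feasible for (DOM) but no $g:I(x)\to E=\emptyset$ exists; connected graphs are taken to be nonempty. *)

(* Defs.v *)
From mathcomp Require Import all_boot all_order all_algebra.
From mathcomp Require Import reals.

Set Implicit Arguments.
Unset Strict Implicit.
Unset Printing Implicit Defensive.

Import GRing.Theory.
Local Open Scope ring_scope.

Section Graphs.
Variables (T : finType) (F : {set {set T}}).

Definition is_graph : Prop := forall e, e \in F -> #|e| = 2%N.

Definition adj : rel T := [rel u v | [set u; v] \in F].

(* The graph without nodes is not considered connected. *)
Definition connected_graph : Prop :=
  (0 < #|T|)%N /\ forall u v : T, connect adj u v.

End Graphs.

Section Problems.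
Variables (R : realType) (V : finType) (E : {set {set V}}).
Variables (MI MP : {set V}) (cI cP : V -> R).

Implicit Types (x z : {ffun V -> bool}) (w : {ffun V * V -> bool}).

Definition vanishes_outside (M : {set V}) x : Prop :=
  forall i, i \notin M -> x i = false.

Definition injections x : {set V} := [set i | x i].

Definition pmu_cover z : {set V} :=
  [set i | z i || [exists k, z k && ([set i; k] \in E)]].

(* The node set V u {0} is [option V], with 0 rendered as [None]. *)
Definition pmu_edges z : {set {set option V}} :=
  [set [set Some i; None] | i in pmu_cover z].

(* [g] is only constrained and only used on [injections x], so it stands for a
   map defined on I(x) alone; [Some @: e] is the edge e viewed in V u {0}. *)
Definition perfect_protection x z : Prop :=
  exists g : V -> {set V},
    (forall i, i \in injections x -> g i \in E /\ i \in g i) /\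
    connected_graph
      (pmu_edges z :|: [set Some @: e | e : {set V} in g @: injections x]).

Definition pp_objective x z : R :=
  \sum_(i in MI) cI i * (x i)%:R + \sum_(k in MP) cP k * (z k)%:R.

(* Sums of binary variables are taken in nat, via the coercion of bool. *)
Definition dom_feasible x z w : Prop :=
  [/\ vanishes_outside MI x /\ vanishes_outside MP z,
      forall i, (1 <= z i + \sum_(k | [set i; k] \in E) z k
                      + \sum_j w (i, j))%N,
      forall j, (\sum_i w (i, j) <= x j)%N,
      forall i j, i != j -> [set i; j] \notin E -> w (i, j) = false &
      (1 <= \sum_(k in MP) z k)%N].

Definition dom_objective x z w : R :=
  \sum_(i in MI) cI i * (x i)%:R + \sum_(k in MP) cP k * (z k)%:R.

End Problems.

(* Main.v *)
Require Import Defs.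
From mathcomp Require Import all_boot all_order all_algebra.
From mathcomp Require Import reals.

(** Call a node uncovered if it lies outside P(z).  Perfect protection and the
    constraints of (DOM) both say the same thing: P(z) is nonempty, and the
    uncovered nodes can be matched injectively with measured injections, each
    uncovered node i with f(i) = i or with a neighbour f(i) of i
    ([is_matching]).  For (DOM) this is a matter of reading w as the graph of f
    ([dom_feasible_iff_matching]).

    From protection to a matching ([matching_of_protection]): in the connected
    graph on V with the extra node 0, each uncovered node i has a neighbour
    p(i) closer to 0.  The edge {i, p(i)} does not touch 0, so it is g(j) for
    one of its two ends j, and f(i) := j.  The map is injective because two
    nodes with the same edge {i, p(i)} would each be closer to 0 than the other.

    From a matching to protection ([protection_of_matching]): let S be the set
    of nodes from which iterating f leads into P(z).  On S the edges
    g(f(i)) := {i, f(i)}, for i uncovered, join every node to P(z), hence to 0.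
    The complement B of S is mapped into itself by f, injectively, hence onto
    itself; so every node of B has a measured injection that is not needed on S,
    and is free to select the first edge of a shortest path in (V, E) from that
    node to S.  The remaining injections select any incident edge. *)

Set Implicit Arguments.
Unset Strict Implicit.
Unset Printing Implicit Defensive.

(** * Graphs and shortest paths *)

Section GraphLemmas.
Variable T : finType.
Implicit Types (F : {set {set T}}) (A : {set T}).

Lemma adj_sym F : symmetric (adj F).
Proof. by move=> u v; rewrite /adj /= setUC. Qed.

(** Take for d the distance to A and for p the next node on a shortest path.
    Both directions of the proof only need that p follows edges and that d
    decreases along p. *)
Lemma shortest_path_forest (e : rel T) A :
  (forall u, exists2 a, a \in A & connect e u a) ->
  exists (d : T -> nat) (p : T -> T),
    forall u, u \notin A -> e u (p u) /\ d (p u) < d u.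
Proof.
move=> reachA.
pose walk u n := [exists t : n.-tuple T, path e u t && (last u t \in A)].
have walkP u : exists n, walk u n.
  have [a aA /connectP[s es def_a]] := reachA u.
  by exists (size s); apply/existsP; exists (in_tuple s); rewrite es -def_a.
pose d u := ex_minn (walkP u).
suff /fin_all_exists[p pP] u :
    exists v, u \notin A -> e u v /\ d v < d u by exists d, p.
have [_ | uA] := boolP (u \in A); first by exists u.
rewrite {2}/d; case: ex_minnP => n /existsP[[s /= /eqP <-]].
case: s => [|v s] /=; first by rewrite (negPf uA).
case/andP=> /andP[euv es] lastA _; exists v => _; split=> //.
rewrite ltnS /d; case: ex_minnP => m _; apply.
by apply/existsP; exists (in_tuple s); rewrite es.
Qed.

(** A node without neighbours reaches only itself, so it would be alone. *)
Lemma connected_has_neighbour F u :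
  connected_graph F -> #|T| != 1 -> exists v, adj F u v.
Proof.
move=> [_ connF] cardT; apply/existsP; apply: contraNT cardT.
rewrite negb_exists => /forallP isolated.
apply/eqP; apply: (@eq_card1 _ u) => v; rewrite !inE; apply/esym/eqP.
have /connectP[[|y s] //= es _] := connF u v.
by move: es; rewrite (negPf (isolated y)).
Qed.

End GraphLemmas.

(** * Matchings of the uncovered nodes *)

Section Matchings.
Variables (V : finType) (E : {set {set V}}).
Implicit Types (x z : {ffun V -> bool}) (w : {ffun V * V -> bool}).

Definition is_matching x z (f : V -> V) : Prop :=
  [/\ forall i, i \notin pmu_cover E z -> x (f i),
      forall i, i \notin pmu_cover E z -> i != f i -> adj E i (f i) &
      {in ~: pmu_cover E z &, injective f}].

Lemma pmu_cover_neq0 z : (pmu_cover E z != set0) = [exists k, z k].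
Proof.
apply/set0Pn/existsP => [[i]|[k zk]]; last by exists k; rewrite inE zk.
by rewrite inE => /orP[zi | /existsP[k /andP[zk _]]]; [exists i | exists k].
Qed.

(** The first two sums in the covering constraint count the reasons for i to
    be in P(z), so what is left is that uncovered nodes have a positive row. *)
Lemma covering_constraintE z w i :
  (1 <= z i + \sum_(k | [set i; k] \in E) z k + \sum_j w (i, j)) =
  (i \in pmu_cover E z) || [exists j, w (i, j)].
Proof.
rewrite !addn_gt0 inE lt0b; congr (_ || _ || _).
  rewrite lt0n sum_nat_eq0 negb_forall; apply: eq_existsb => k.
  by rewrite negb_imply eqb0 negbK andbC.
rewrite lt0n sum_nat_eq0 negb_forall; apply: eq_existsb => j.
by rewrite eqb0 negbK.
Qed.

(** The constraints on w say that its columns have at most one 1, which makes f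
    injective, and only where x is 1.  A row of w may have several 1s, so f
    selects one of them; conversely f gives a w with empty rows on P(z). *)
Lemma dom_feasible_iff_matching (MI MP : {set V}) x z :
  vanishes_outside MI x -> vanishes_outside MP z ->
  (exists w, dom_feasible E MI MP x z w) <->
  pmu_cover E z != set0 /\ exists f, is_matching x z f.
Proof.
move=> x_MI z_MP; split.
- case=> w [_ rows cols adjw pmu]; split.
    rewrite pmu_cover_neq0; move: pmu; rewrite lt0n sum_nat_eq0 negb_forall.
    case/existsP=> k; rewrite negb_imply eqb0 negbK => /andP[_ zk].
    by apply/existsP; exists k.
  have /fin_all_exists[f fP] i :
      exists j, i \notin pmu_cover E z -> w (i, j).
    have := rows i; rewrite covering_constraintE.
    by case: (i \in _) => [_ | /existsP[j wij]]; [exists i | exists j].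
  exists f; split=> [i iP | i iP ifi | i1 i2].
  + by have := cols (f i); rewrite (bigD1 i) //= (fP i iP); case: (x _).
  + by apply: contraT => nadj; rewrite -(adjw _ _ ifi nadj) (fP i iP).
  + rewrite !in_setC => i1P i2P f12; apply/eqP; apply: contraT => neq12.
    have := leq_trans (cols (f i1)) (leq_b1 _).
    rewrite (bigD1 i1) //= (bigD1 i2) 1?eq_sym //= (fP _ i1P).
    by rewrite f12 (fP _ i2P).
- case=> P0 [f [xf adjf injf]].
  exists [ffun ij => (ij.1 \notin pmu_cover E z) && (f ij.1 == ij.2)].
  split=> [// | i | j | i j neq_ij nadj |].
  + rewrite covering_constraintE; case: (boolP (i \in _)) => //= iP.
    by apply/existsP; exists (f i); rewrite ffunE /= iP eqxx.
  + have [/existsP[i /andP[iP /eqP fi]] | none] :=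
        boolP [exists i, (i \notin pmu_cover E z) && (f i == j)].
      rewrite (bigD1 i) //= big1 ?addn0 => [|i' neq_i'].
        by rewrite -fi xf // leq_b1.
      rewrite ffunE /=; case: (boolP (i' \in _)) => //= i'P.
      case: eqP => // fi'; case/eqP: neq_i'.
      by apply: injf; rewrite ?in_setC // fi' fi.
    rewrite big1 // => i _; rewrite ffunE /=.
    by move: none; rewrite negb_exists => /forallP/(_ i)/negPf->.
  + rewrite ffunE /=; apply/negP => /andP[iP /eqP fi]; case/negP: nadj.
    by rewrite -fi; apply: adjf; rewrite ?fi.
  + move: P0; rewrite pmu_cover_neq0 => /existsP[k zk].
    have kMP : k \in MP by apply: contraT => /z_MP; rewrite zk.
    by rewrite (bigD1 k) //= zk.
Qed.

(** * Matchings and perfect protection *)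

Definition protection_edges x z (g : V -> {set V}) : {set {set option V}} :=
  pmu_edges E z :|: [set Some @: e | e : {set V} in g @: injections x].

Lemma adj_protection_SomeNone x z g i :
  adj (protection_edges x z g) (Some i) None = (i \in pmu_cover E z).
Proof.
apply/idP/idP => [|iP]; last first.
  by rewrite /adj /= in_setU; apply/orP; left; apply/imsetP; exists i.
rewrite /adj /= in_setU => /orP[/imsetP[k kP] /setP/(_ (Some i)) | /imsetP[e _]].
  by rewrite set21 in_set2 => /esym/orP[/eqP[->] | /eqP].
by move/setP/(_ None); rewrite set22 => /esym/imsetP[].
Qed.

Lemma adj_protection_SomeSome x z g i k :
  adj (protection_edges x z g) (Some i) (Some k) <->
  exists2 j, x j & g j = [set i; k].
Proof.
have ikE : [set Some i; Some k] = Some @: [set i; k] by rewrite imsetU1 imset_set1.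
split=> [|[j xj gj]]; last first.
  rewrite /adj /= in_setU ikE -gj; apply/orP; right.
  by rewrite !imset_f // inE.
rewrite /adj /= in_setU => /orP[/imsetP[l _] /setP/(_ None) | /imsetP[e]].
  by rewrite !inE.
case/imsetP=> j; rewrite inE => xj -> ; rewrite ikE => /imset_inj eq_e.
by exists j => //; rewrite eq_e //; apply: Some_inj.
Qed.

(** Towards 0 each uncovered node i leaves along an edge g(j) having i as an end,
    and f(i) := j.  No edge is left from both ends, since the distance to 0
    decreases in the direction of travel. *)
Lemma matching_of_protection x z :
  connected_graph E -> perfect_protection E x z ->
  pmu_cover E z != set0 /\ exists f, is_matching x z f.
Proof.
move=> [/card_gt0P[v _] _] [g [gP [_ connH]]].
rewrite -/(protection_edges x z g) in connH.
split.
  have /connectP[[|[i|] s] //= /andP[edge _] _] := connH None (Some v).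
    apply/set0Pn; exists i.
    by rewrite -(adj_protection_SomeNone x z g) adj_sym.
  (* A path cannot start with a loop at 0, which would be a singleton edge. *)
  move: edge; rewrite /adj /= setUid in_setU => /orP[] /imsetP[e].
    by move=> _ /setP/(_ (Some e)); rewrite !inE eqxx.
  by move=> _ /setP/(_ None); rewrite !inE => /esym/imsetP[].
have reach0 u : exists2 a, a \in [set None : option V]
    & connect (adj (protection_edges x z g)) u a.
  by exists None; rewrite ?inE.
have [d [p dp]] := shortest_path_forest reach0.
have /fin_all_exists2[f fP fP'] i : exists2 j, i \notin pmu_cover E z -> x j &
    i \notin pmu_cover E z ->
    exists2 k, d (Some k) < d (Some i) & g j = [set i; k].
  have [_ | iP] := boolP (i \in pmu_cover E z); first by exists i.
  have [|edge lt_d] := dp (Some i); first by rewrite inE.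
  case def_k: (p (Some i)) edge lt_d => [k|] edge lt_d; last first.
    by move: edge; rewrite adj_protection_SomeNone (negPf iP).
  have /adj_protection_SomeSome[j xj gj] := edge.
  by exists j => // _; exists k.
exists f; split=> // [i iP neq | i1 i2].
  have [k _ gf] := fP' i iP.
  have [] := gP (f i); first by rewrite inE fP.
  rewrite gf !inE [f i == i]eq_sym (negPf neq) /= => ikE /eqP def_fi.
  by rewrite /adj /= def_fi.
rewrite !in_setC => i1P i2P f12.
have [k1 d1 g1] := fP' _ i1P; have [k2 d2 g2] := fP' _ i2P.
have e12 : [set i1; k1] = [set i2; k2] by rewrite -g1 f12.
have := set21 i1 k1; rewrite e12 !inE => /orP[/eqP// | /eqP i1k2].
have := set21 i2 k2; rewrite -e12 !inE => /orP[/eqP// | /eqP i2k1].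
by move: d2; rewrite -i1k2 i2k1 ltnNge (ltnW d1).
Qed.

(** Iterating f may run into cycles, or fixed points, that never meet P(z), and
    there the edges {i, f(i)} do not lead to 0.  These cycles consist of nodes
    with measured injections only, which can all be redirected along shortest
    paths in (V, E).  The hypothesis on neighbours serves injections at nodes
    that f assigns to no uncovered node, which still have to select some
    incident edge. *)
Lemma protection_of_matching x z f :
  connected_graph E ->
  (forall j, x j -> exists k, adj E j k) ->
  pmu_cover E z != set0 -> is_matching x z f -> perfect_protection E x z.
Proof.
move=> [_ connE] nbr /set0Pn[p0 p0P] [xf adjf injf].
set P := pmu_cover E z in p0P xf adjf injf.
(* Stopping the iteration on P makes its points fixed, so S is the set of nodes
   whose orbit under h meets P. *)
pose h i := if i \in P then i else f i.
pose S := [set i | [exists a in P, fconnect h i a]].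
have PS a : a \in P -> a \in S.
  by move=> aP; rewrite inE; apply/existsP; exists a; rewrite aP connect0.
have fS i : i \notin P -> f i \in S -> i \in S.
  move=> iP; rewrite !inE => /existsP[a /andP[aP fia]].
  apply/existsP; exists a; rewrite aP; apply: connect_trans fia.
  by apply: connect1; rewrite /= /h (negPf iP).
(* A fixed point of f outside P is its own orbit, so it is not in S. *)
have S_moves i : i \in S -> i \notin P -> i != f i.
  rewrite inE => /existsP[a /andP[aP /iter_findex itera]] iP.
  apply: contra iP => /eqP fi.
  have fix_i n : iter n h i = i.
    by elim: n => //= n ->; rewrite /h -fi if_same.
  by rewrite -(fix_i (findex h i a)) itera.
have notSP i : i \notin S -> i \notin P by apply: contra => /PS.
(* An injective self-map of the complement of S is onto. *)
have onto : f @: (~: S) = ~: S.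
  apply/eqP; rewrite eqEcard card_in_imset => [|i1 i2]; last first.
    by rewrite !in_setC => /notSP iP1 /notSP iP2; apply: injf; rewrite in_setC.
  rewrite leqnn andbT; apply/subsetP => _ /imsetP[i iS ->].
  by move: iS; rewrite !in_setC => iS; apply: contra (iS); apply: fS (notSP _ iS).
have reachS u : exists2 a, a \in S & connect (adj E) u a.
  by exists p0; rewrite ?PS.
have [d [p dp]] := shortest_path_forest reachS.
have /fin_all_exists[g gP] j : exists e : {set V}, x j ->
    [/\ e \in E, j \in e, j \notin S -> e = [set j; p j] &
        forall i, i \in S -> i \notin P -> f i = j -> e = [set i; j]].
  have [xj | _] := boolP (x j); last by exists set0.
  have [jS | jS] := boolP (j \in S); last first.
    have [edge _] := dp j jS; exists [set j; p j] => _; split=> //.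
      exact: set21.
    (* By surjectivity j = f(i') with i' outside S, so i = i' by injectivity. *)
    move=> i iS iP fi; have: j \in f @: (~: S) by rewrite onto in_setC.
    case/imsetP=> i'; rewrite in_setC => i'S def_j.
    have eq_i : i = i' by apply: injf; rewrite ?in_setC ?fi //; apply: notSP.
    by rewrite eq_i (negPf i'S) in iS.
  have [/existsP[i /and3P[iS iP /eqP fi]] | none] :=
      boolP [exists i, [&& i \in S, i \notin P & f i == j]].
    exists [set i; j] => _; split=> //.
    + by rewrite -fi; apply: adjf => //; apply: S_moves.
    + exact: set22.
    + move=> i' i'S i'P fi'; congr [set _; j].
      by apply: injf; rewrite ?in_setC // fi fi'.
  have [k jk] := nbr j xj.
  exists [set j; k] => _; split=> //; first exact: set21.
  move=> i iS iP fi; case/existsP: none; exists i.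
  by rewrite iS iP fi eqxx.
exists g; split=> [j|]; first by rewrite inE => /gP[].
rewrite -/(protection_edges x z g); pose H := adj (protection_edges x z g).
have symH : connect_sym H by apply: sym_connect_sym; apply: adj_sym.
have conn_iter n i : iter n h i \in P -> connect H (Some i) None.
  elim: n i => [|n IHn] i.
    by move=> iP; apply: connect1; rewrite /H adj_protection_SomeNone.
  have [iP _ | iP] := boolP (i \in P).
    by apply: connect1; rewrite /H adj_protection_SomeNone.
  rewrite iterSr => hP.
  have hi : h i = f i by rewrite /h (negPf iP).
  have iS : i \in S.
    rewrite inE; apply/existsP; exists (iter n h (h i)).
    by rewrite hP -iterSr fconnect_iter.
  apply: connect_trans (IHn _ hP); apply: connect1; rewrite hi.
  apply/adj_protection_SomeSome; exists (f i); first exact: xf.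
  by have [_ _ _ /(_ i)->] := gP _ (xf i iP).
have connS i : i \in S -> connect H (Some i) None.
  rewrite inE => /existsP[a /andP[aP /iter_findex itera]].
  by apply: (conn_iter (findex h i a)); rewrite itera.
have conn0 i : connect H (Some i) None.
  have [n le_n] := ubnP (d i); elim: n i le_n => // n IHn i.
  rewrite ltnS => le_n; have [/connS// | iS] := boolP (i \in S).
  have [_ lt_d] := dp i iS.
  apply: connect_trans (IHn _ (leq_trans lt_d le_n)); apply: connect1.
  have xi : x i.
    have: i \in f @: (~: S) by rewrite onto in_setC.
    by case/imsetP=> i'; rewrite in_setC => /notSP i'P ->; apply: xf.
  apply/adj_protection_SomeSome; exists i => //.
  by have [_ _ -> //] := gP _ xi.
have conn0' u : connect H u None by case: u => [i|]; [apply: conn0|].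
split=> [|u v]; first by rewrite card_option.
by apply: (connect_trans (conn0' u)); rewrite symH.
Qed.

End Matchings.

Theorem mainTheorem6 (R : realType) (V : finType) (E : {set {set V}})
    (MI MP : {set V}) (cI cP : V -> R)
    (graphE : is_graph E) (connE : connected_graph E)
    (* excludes the one-node instance in which E is empty but MI and MP are not *)
    (nondeg : #|V| = 1 -> MI = set0 \/ MP = set0) :
  (forall (x z : {ffun V -> bool}) (w : {ffun V * V -> bool}),
     dom_objective MI MP cI cP x z w = pp_objective MI MP cI cP x z) /\
  (forall x z : {ffun V -> bool},
     vanishes_outside MI x -> vanishes_outside MP z ->
     (perfect_protection E x z <->
      exists w : {ffun V * V -> bool}, dom_feasible E MI MP x z w)).
Proof.
split=> // x z x_MI z_MP.
split=> [pp | /(dom_feasible_iff_matching E x_MI z_MP)[P0 [f fM]]].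
  by apply/(dom_feasible_iff_matching E x_MI z_MP)/matching_of_protection.
apply: protection_of_matching fM => // j xj.
(* On one node there is no edge, but then x or z vanishes. *)
apply: connected_has_neighbour => //; apply/eqP => /nondeg[M0 | M0].
  by rewrite x_MI ?M0 ?inE in xj.
move: P0; rewrite pmu_cover_neq0 => /existsP[k].
by rewrite z_MP // M0 inE.
Qed.
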